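(* Let $G,H$ be finite simple connected graphs, fix a root $(r_G,r_H)\in V(G\,\square\,H)$, let $K\in\{G,H\}$ with $\bar K$ the other graph, and let $(S,T)$ be an ordered pair of disjoint subsets of $V(\bar K)$ such that $i\sim_{\bar K} j$ for all $i\in S$, $j\in T$. Put $M=2\pi(G)\pi(H)$. Then every configuration $c$ on $G\,\square\,H$ from which no sequence of pebbling moves places a pebble on $(r_G,r_H)$ satisfies \[ \sum_{i\in S}pair_{K,i}+1\ \le\ \sum_{j\in T}\bigl(\pi(K)-extra_{K,j}\bigr)+M\Bigl(|S|-\sum_{i\in S}x_{K,i,1}\Bigr)+M\bigl(1-y_{K,\pi(\bar K)-|T|}\bigr). \]
   Context: The Cartesian product $G\,\square\,H$ has vertex set $V(G)\times V(H)$, with $(g,h)\sim(g',h')$ iff ($g=g'$ and $h\sim_H h'$) or ($h=h'$ and $g\sim_G g'$). $|X|$ is the number of vertices of $X$. A configuration is a function $c:V(G\,\square\,H)\to\mathbb{Z}_{\ge0}$. A pebbling move removes two pebbles from a vertex and adds one to an adjacent vertex. $\pi(X)$ (pebbling number) is the least $k$ such that from every configuration of size $k$ on $X$ and every root some sequence of pebbling moves places a pebble on the root. For $K\in\{G,H\}$, $\bar K$ is the other graph; for $j\in V(\bar K)$ the $K$-slice $K_j$ is $\{(i,j):i\in V(G)\}$ if $K=G$ and $\{(j,h):h\in V(H)\}$ if $K=H$. For a configuration $c$: $\tilde c_{K,j}=\sum_{u\in K_j}c(u)$; $set_{K,j}=\lfloor\tilde c_{K,j}/\pi(K)\rfloor$;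 $extra_{K,j}=\tilde c_{K,j}-\pi(K)\,set_{K,j}$; $pair_{K,j}=\lfloor extra_{K,j}/2\rfloor$; $sat_{K,j}=\lfloor(\tilde c_{K,j}-extra_{K,j})/|K|\rfloor$; $x_{K,j,t}=1$ if $sat_{K,j}\ge t$ and $0$ otherwise; $y_{K,s}=1$ if $\sum_{j\in V(\bar K)}set_{K,j}\ge s$ and $0$ otherwise. *)

(* Defs.v *)
From mathcomp Require Import all_boot all_order all_algebra.
From mathcomp Require Import boolp.

Set Implicit Arguments.
Unset Strict Implicit.
Unset Printing Implicit Defensive.

Record sgraph := SGraph {
  vertex :> finType;
  adj : rel vertex;
  adj_sym : symmetric adj;
  adj_irrefl : irreflexive adj }.

(* The empty graph satisfies this predicate. *)
Definition graph_connected (X : sgraph) : Prop :=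
  forall u v : X, connect (@adj X) u v.

Section CartesianProduct.
Variables G H : sgraph.

Definition cprod_adj : rel (G * H)%type := fun p q =>
  ((p.1 == q.1) && adj p.2 q.2) || ((p.2 == q.2) && adj p.1 q.1).

Lemma cprod_adj_sym : symmetric cprod_adj.
Proof.
by move=> p q; rewrite /cprod_adj ![q.1 == _]eq_sym ![q.2 == _]eq_sym
  (adj_sym q.1) (adj_sym q.2).
Qed.

Lemma cprod_adj_irrefl : irreflexive cprod_adj.
Proof. by move=> p; rewrite /cprod_adj !adj_irrefl !andbF. Qed.

Definition cprod : sgraph := SGraph cprod_adj_sym cprod_adj_irrefl.

End CartesianProduct.

Section Pebbling.
Variable X : sgraph.

Definition config := {ffun X -> nat}.

Definition config_size (c : config) : nat := \sum_(v : X) c v.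

Definition pebbling_move (c : config) (u v : X) : config :=
  [ffun w => if w == u then c w - 2 else if w == v then c w + 1 else c w].

Inductive reachable : config -> config -> Prop :=
| reachable_refl (c : config) : reachable c c
| reachable_step (c : config) (u v : X) (c' : config) :
    adj u v -> 2 <= c u -> reachable (pebbling_move c u v) c' -> reachable c c'.

Definition pebble_solvable (c : config) (r : X) : Prop :=
  exists2 c', reachable c c' & 0 < c' r.

Definition always_solvable (k : nat) : Prop :=
  forall (c : config) (r : X), config_size c = k -> pebble_solvable c r.

(* The value 0 in the second case is never used for connected graphs, see
   pebbling_numberP. *)
Definition pebbling_number : nat :=
  if pselect (exists k, `[< always_solvable k >]) is left ex_k
  then ex_minn ex_k else 0.

Lemma reachable_trans c1 c2 c3 :
  reachable c1 c2 -> reachable c2 c3 -> reachable c1 c3.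
Proof.
move=> r12; elim: r12 c3 => // c u v c' uv cu _ IH c3 /IH.
exact: reachable_step.
Qed.

Lemma reachable_carry (c : config) (u v : X) m :
  adj u v -> 2 * m <= c u -> exists2 c', reachable c c' & c v + m <= c' v.
Proof.
move=> uv; elim: m c => [|m IH] c cu.
  by exists c; [exact: reachable_refl | rewrite addn0].
have vu : (v == u) = false.
  by apply/eqP => vu; move: uv; rewrite vu adj_irrefl.
rewrite mulnS in cu; have cu2 : 2 <= c u := leq_trans (leq_addr _ _) cu.
have [|c' rc' cv] := IH (pebbling_move c u v).
  by rewrite ffunE eqxx leq_subRL.
exists c'; first exact: reachable_step rc'.
by move: cv; rewrite ffunE vu eqxx -addnA add1n.
Qed.

Lemma solvable_path (c : config) (u : X) p :
  path (@adj X) u p -> 2 ^ size p <= c u -> pebble_solvable c (last u p).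
Proof.
elim: p u c => [|v p IH] u c /=.
  by move=> _ cu; exists c; first exact: reachable_refl.
case/andP=> uv vp; rewrite expnS => cu.
have [c' rc c'v] := reachable_carry uv cu.
have [|c2 r2 h2] := IH v c' vp; first exact: leq_trans (leq_addl _ _) c'v.
by exists c2 => //; exact: reachable_trans rc r2.
Qed.

Lemma always_solvable_ex :
  graph_connected X -> exists k, always_solvable k.
Proof.
move=> conX; exists (#|X| * 2 ^ #|X|) => c r size_c.
case: (boolP [exists u, 2 ^ #|X| <= c u]) => [/existsP[u cu]|/existsPn small].
  have /connectP[p up ->] := conX u r.
  have [q uq uniq_q _] := shortenP up.
  apply: solvable_path => //; apply: leq_trans cu.
  rewrite leq_exp2l //; have := max_card (mem (u :: q)).
  by rewrite (card_uniqP uniq_q); apply: ltnW.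
suff: config_size c < #|X| * 2 ^ #|X| by rewrite size_c ltnn.
rewrite /config_size -sum_nat_const (bigD1 r) //= [ltnRHS](bigD1 r) //=.
rewrite -addSn leq_add //; first by rewrite ltnNge.
by apply: leq_sum => u _; rewrite ltnW // ltnNge.
Qed.

Lemma pebbling_numberP : graph_connected X ->
  always_solvable pebbling_number /\
  forall k, always_solvable k -> pebbling_number <= k.
Proof.
move=> conX; rewrite /pebbling_number; case: pselect => [ex_k|[]]; last first.
  by have [k kP] := always_solvable_ex conX; exists k; apply/asboolP.
case: ex_minnP => m /asboolP mP m_min; split=> // k kP.
by apply: m_min; apply/asboolP.
Qed.

End Pebbling.

(* The choice of K in {G, H}. *)
Inductive side := SideG | SideH.

Section Slices.
Variables (G H : sgraph) (K : side).

Definition graphK : sgraph := if K is SideG then G else H.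
Definition graphKbar : sgraph := if K is SideG then H else G.

Definition slice : graphKbar -> {set cprod G H} :=
  match K return (if K is SideG then H else G) -> {set cprod G H} with
  | SideG => fun j => [set ((i, j) : cprod G H) | i : G]
  | SideH => fun j => [set ((j, h) : cprod G H) | h : H]
  end.

Variable c : config (cprod G H).

Definition slice_size (j : graphKbar) : nat := \sum_(u in slice j) c u.

Definition slice_set (j : graphKbar) : nat :=
  slice_size j %/ pebbling_number graphK.

(* The natural-number subtractions in slice_extra and slice_sat are never
   truncated. *)
Definition slice_extra (j : graphKbar) : nat :=
  slice_size j - pebbling_number graphK * slice_set j.

Definition slice_pair (j : graphKbar) : nat := slice_extra j %/ 2.

Definition slice_sat (j : graphKbar) : nat :=
  (slice_size j - slice_extra j) %/ #|graphK|.

Definition x_ind (j : graphKbar) (t : nat) : nat :=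
  if t <= slice_sat j then 1 else 0.

Definition y_ind (s : int) : nat :=
  if (s <= (\sum_(j : graphKbar) slice_set j)%N%:Z)%R then 1 else 0.

End Slices.

(* Main.v *)
Require Import Defs.
From mathcomp Require Import all_boot all_order all_algebra.
From mathcomp Require Import zify.

Set Implicit Arguments.
Unset Strict Implicit.
Unset Printing Implicit Defensive.

(** If some [x_{K,i,1}] or the [y] vanishes, the corresponding term [M]
    dominates, because [|X| <= pi(X)].  Otherwise, suppose the inequality fails.
    A slice [K_i] with [i] in [S] holds at least [|K| + 2 pair_{K,i}] pebbles,
    so by pigeonhole [pair_{K,i}] moves out of it are possible, and they leave
    its [set_{K,i}] sets untouched.  These moves suffice to complete one further
    set in every [K_j], [j] in [T], giving at least [pi(Kbar)] sets in total.
    Each set puts a pebble on the copy of the root of [K] in its slice, and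
    these [pi(Kbar)] pebbles then solve the root inside a copy of [Kbar]. *)

(** * Transporting moves between graphs and gathering pebbles *)

(* [c'] results from [c] by replacing the image of [a] with that of [a']; the
   equation is stated without subtraction. *)
Lemma reachable_lift (A X : sgraph) (f : A -> X) (a a' : config A)
    (c : config X) :
  injective f -> {homo f : u v / adj u v} -> reachable a a' ->
  (forall v, a v <= c (f v)) ->
  exists c' : config X, [/\ reachable c c',
    forall v, c' (f v) + a v = c (f v) + a' v &
    forall x, x \notin codom f -> c' x = c x].
Proof.
move=> injf homf ra; elim: ra c => {a a'} [a c _|a u v a' uv au _ IH c ac].
  by exists c; split=> //; exact: reachable_refl.
have neuv : u != v by apply: contraTneq uv => ->; rewrite adj_irrefl.
(* The same move on both sides keeps the surplus of [c] over [a], so domination persists. *)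
have [|c' [rc' c'f c'x]] := IH (pebbling_move c (f u) (f v)).
  move=> w; rewrite !ffunE !(inj_eq injf); have := ac w.
  by case: (w == u) => /=; case: (w == v) => /=; lia.
exists c'; split.
- by apply: reachable_step rc'; [exact: homf | exact: leq_trans au (ac u)].
- move=> w; have := c'f w; rewrite !ffunE !(inj_eq injf); have := ac w.
  have [->|_] := eqVneq w u; first by lia.
  by case: (w == v) => /=; lia.
move=> x xf; rewrite c'x // ffunE.
have [xu|_] := eqVneq x (f u); first by rewrite xu codom_f in xf.
by have [xv|//] := eqVneq x (f v); rewrite xv codom_f in xf.
Qed.

(** [always_solvable] speaks only of configurations of size exactly [k]; larger ones are cut down to
    that size. *)
Lemma subconfig_ex (X : sgraph) (c : config X) k : k <= config_size c ->
  exists2 d : config X, config_size d = k & forall v, d v <= c v.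
Proof.
elim: k => [|k IH] kc.
  by exists [ffun=> 0]; [rewrite /config_size big1 // => v|move=> v]; rewrite ffunE.
have [d dk dc] := IH (ltnW kc).
have [/forallP dec|/forallPn[v]] := boolP [forall v, c v <= d v].
  by move: kc; rewrite -dk ltnNge => /negP[]; apply: leq_sum => v _.
rewrite -ltnNge => dcv.
exists [ffun w => d w + (w == v)].
  rewrite -dk /config_size (eq_bigr (fun w => d w + (w == v))); last first.
    by move=> w _; rewrite ffunE.
  by rewrite big_split /= -big_mkcond /= big_pred1_eq addn1.
by move=> w; rewrite ffunE; have := dc w; have [->|] := eqVneq w v => /=; lia.
Qed.

(** The pebbles split into blocks of size [k]. Each block delivers one pebble to [r] by itself, and
    moves of one block never spend pebbles of another. *)
Lemma always_solvable_gather (X : sgraph) k m (c : config X) (r : X) :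
  always_solvable X k -> k * m <= config_size c ->
  exists2 c', reachable c c' & m <= c' r.
Proof.
move=> solk; elim: m c => [|m IH] c kc; first by exists c; [exact: reachable_refl|].
have [|d dk dc] := @subconfig_ex X c k; first by move: kc; rewrite mulnS; lia.
have [d' rd d'r] := solk d r dk.
have [||c' [rc' c'E _]] := @reachable_lift X X id d d' c _ _ rd dc => //.
(* The pebbles outside the block [d]: they survive its moves, and at least [k * m] of them are left
   for the induction. *)
pose e : config X := [ffun v => c v - d v].
have [|e' re e'r] := IH e.
  have : config_size e + config_size d = config_size c.
    rewrite /config_size -big_split; apply: eq_bigr => v _ /=.
    by rewrite ffunE subnK.
  by move: kc; rewrite mulnS dk; lia.
have ec' v : e v <= c' v.
  by rewrite ffunE; have := c'E v; have := dc v => /=; lia.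
have [||c2 [rc2 c2E _]] := @reachable_lift X X id e e' c' _ _ re ec' => //.
exists c2; first exact: reachable_trans rc' rc2.
by have := c2E r; have := c'E r; have := dc r; rewrite ffunE /=; lia.
Qed.

(** * The bound of the order of a graph by its pebbling number *)

Lemma reachable_frozen (X : sgraph) (c c' : config X) :
  (forall v, c v <= 1) -> reachable c c' -> c' = c.
Proof.
move=> c1 rc; case: rc c1 => // d u v d' _ du _ d1.
by have := leq_trans du (d1 u).
Qed.

(** Otherwise [k] vertices other than [r] can carry one pebble each; no move is then possible and
    [r] stays empty. *)
Lemma card_le_always_solvable (X : sgraph) k (r : X) :
  always_solvable X k -> #|X| <= k.
Proof.
move=> solk; rewrite leqNgt; apply/negP => kX.
pose s := take k (enum [set~ r]).
have us : uniq s by rewrite take_uniq // enum_uniq.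
have sk : size s = k.
  by rewrite size_takel // -cardE cardsC1; lia.
pose c : config X := [ffun v => (v \in s) : nat].
have [|c' rc c'r] := solk c r.
  rewrite /config_size (eq_bigr (fun v => (v \in s) : nat)); last first.
    by move=> v _; rewrite ffunE.
  by rewrite -big_mkcond sum1_card (card_uniqP us).
move: c'r; rewrite (reachable_frozen _ rc) => [|v]; last first.
  by rewrite ffunE; case: (v \in s).
rewrite ffunE; case: (boolP (r \in s)) => // /mem_take.
by rewrite mem_enum !inE eqxx.
Qed.

Lemma card_le_pebbling_number (X : sgraph) (r : X) :
  graph_connected X -> #|X| <= pebbling_number X.
Proof. by move=> /pebbling_numberP[solX _]; exact: card_le_always_solvable r solX. Qed.

(** * Moving pebbles within and between slices *)

(* Treats both choices of [K] at once: [e a b] is the vertex of the product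
   lying in the slice [b] of [A] over the vertex [a]. *)
Section Product.
Variables (A B X : sgraph) (e : A -> B -> X).
Hypothesis e_inj : forall a a' b b', e a b = e a' b' -> a = a' /\ b = b'.
Hypothesis e_adjl : forall a a' b, adj a a' -> adj (e a b) (e a' b).
Hypothesis e_adjr : forall a b b', adj b b' -> adj (e a b) (e a b').
Hypotheses (conA : graph_connected A) (conB : graph_connected B).

Local Notation piA := (pebbling_number A).
Local Notation piB := (pebbling_number B).

Definition fiber_size (c : config X) (b : B) := \sum_(a : A) c (e a b).

(** The slices are treated one after another. Moves inside one slice do not touch the others, so
    each still has its contents from [c] when its turn comes. *)
Lemma fibers_gather (c : config X) (r : A) (s : seq B) : uniq s ->
  exists c' : config X, [/\ reachable c c',
    forall b, b \in s -> fiber_size c b %/ piA <= c' (e r b) &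
    forall a b, b \notin s -> c' (e a b) = c (e a b)].
Proof.
elim: s => [_|b s IH /= /andP[bs us]].
  by exists c; split=> //; exact: reachable_refl.
have [c1 [rc1 c1s c1n]] := IH us.
pose d : config A := [ffun a => c (e a b)].
have [|d' rd d'r] :=
  always_solvable_gather (m := fiber_size c b %/ piA) (c := d) r (pebbling_numberP conA).1.
  rewrite /config_size; under eq_bigr do rewrite ffunE.
  by rewrite mulnC leq_divM.
have [|||c2 [rc2 c2E c2n]] :=
    @reachable_lift A X (fun a => e a b) d d' c1 _ _ rd _.
- by move=> a a' /e_inj[].
- by move=> a a'; exact: e_adjl.
- by move=> a; rewrite ffunE c1n.
have c2nb a b' : b' != b -> c2 (e a b') = c1 (e a b').
  move=> b'b; apply: c2n; apply/codomP => -[a' /e_inj[_ bb]].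
  by rewrite bb eqxx in b'b.
exists c2; split; first exact: reachable_trans rc1 rc2.
  move=> b'; rewrite inE; have [->|b'b] /= := eqVneq b' b.
    by move=> _; have := c2E r; rewrite ffunE c1n //; lia.
  by move=> b's; rewrite c2nb // c1s.
move=> a b'; rewrite inE negb_or => /andP[b'b b's].
by rewrite c2nb // c1n.
Qed.

Lemma solvable_fiber_sets (c : config X) (rA : A) (rB : B) :
  piB <= \sum_(b : B) fiber_size c b %/ piA -> pebble_solvable c (e rA rB).
Proof.
move=> sets; have [c1 [rc1 c1s _]] := fibers_gather c rA (enum_uniq B).
(* The copy of [B] over [rA], which now holds at least one pebble per set. *)
pose d : config B := [ffun b => c1 (e rA b)].
have [|d' rd d'r] :=
  always_solvable_gather (m := 1) (c := d) rB (pebbling_numberP conB).1.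
  rewrite muln1 (leq_trans sets) //; apply: leq_sum => b _.
  by rewrite ffunE c1s // mem_enum.
have [|||c2 [rc2 c2E _]] := @reachable_lift B X (e rA) d d' c1 _ _ rd _.
- by move=> b b' /e_inj[].
- by move=> b b'; exact: e_adjr.
- by move=> b; rewrite ffunE.
exists c2; first exact: reachable_trans rc1 rc2.
by have := c2E rB; rewrite ffunE; lia.
Qed.

Lemma fiber_size_move (c : config X) a i j : adj i j -> 2 <= c (e a i) ->
  let c' := pebbling_move c (e a i) (e a j) in
  [/\ fiber_size c' i + 2 = fiber_size c i, fiber_size c' j = fiber_size c j + 1
    & forall b, b != i -> b != j -> fiber_size c' b = fiber_size c b].
Proof.
move=> ij ci c'.
have neij : i != j by apply: contraTneq ij => ->; rewrite adj_irrefl.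
have eE a1 a2 b1 b2 : (e a1 b1 == e a2 b2) = (a1 == a2) && (b1 == b2).
  by apply/eqP/andP => [/e_inj[-> ->]|[/eqP-> /eqP->]].
split.
- rewrite /fiber_size (bigD1 a) //= [in RHS](bigD1 a) //= ffunE eqxx.
  rewrite (eq_bigr (fun a' => c (e a' i))); first by lia.
  by move=> a' a'a; rewrite ffunE !eE (negbTE a'a).
- rewrite /fiber_size (bigD1 a) //= [in RHS](bigD1 a) //= ffunE !eE !eqxx.
  rewrite eq_sym (negbTE neij) /= (eq_bigr (fun a' => c (e a' j))); first by lia.
  by move=> a' a'a; rewrite ffunE !eE (negbTE a'a).
move=> b bi bj; apply: eq_bigr => a' _.
by rewrite ffunE !eE (negbTE bi) (negbTE bj) !andbF.
Qed.

Lemma fiber_pigeonhole (c : config X) b :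
  #|A| < fiber_size c b -> exists a, 2 <= c (e a b).
Proof.
move=> Ac; apply/existsP; apply: contraLR Ac => /existsPn small.
rewrite -leqNgt -sum1_card; apply: leq_sum => a _.
by have := small a; rewrite -ltnNge.
Qed.

(* [p i] moves leave the slice [i] and [q j] pebbles arrive in the slice [j]. *)
Lemma fibers_transfer (S T : {set B}) (p q : B -> nat) (c : config X) :
  [disjoint S & T] -> (forall i j, i \in S -> j \in T -> adj i j) ->
  (forall i, i \in S -> #|A| + 2 * p i <= fiber_size c i) ->
  \sum_(j in T) q j <= \sum_(i in S) p i ->
  exists c' : config X, [/\ reachable c c',
    forall i, i \in S -> fiber_size c i <= fiber_size c' i + 2 * p i,
    forall j, j \in T -> fiber_size c j + q j <= fiber_size c' j &
    forall b, b \notin S -> b \notin T -> fiber_size c' b = fiber_size c b].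
Proof.
(* Induction on the total demand; each step makes one move from a slice with supply left to one with
   demand left. *)
move=> disST adjST; move Dn: (\sum_(j in T) q j) => n.
elim: n p q c Dn => [|n IH] p q c Dn pc qp.
  exists c; split=> //; first exact: reachable_refl.
    by move=> i _; exact: leq_addr.
  move=> j jT; move/eqP: Dn; rewrite sum_nat_eq0 => /forall_inP/(_ j jT)/eqP->.
  by rewrite addn0.
have /existsP[j /andP[jT qj]] : [exists j, (j \in T) && (0 < q j)].
  apply/contraT => /existsPn q0; move: Dn; rewrite big1 // => j jT.
  by have := q0 j; rewrite jT /=; case: (q j).
have /existsP[i /andP[iS pi]] : [exists i, (i \in S) && (0 < p i)].
  apply/contraT => /existsPn p0; move: qp; rewrite big1 // => i iS.
  by have := p0 i; rewrite iS /=; case: (p i).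
(* As [p i] is positive, the slice [i] holds more than [#|A|] pebbles. *)
have [a ca] : exists a, 2 <= c (e a i).
  by apply: fiber_pigeonhole; have := pc i iS; lia.
have ij := adjST i j iS jT.
have [mi mj mb] := fiber_size_move ij ca.
set c1 := pebbling_move _ _ _ in mi mj mb.
have inT b : b \in S -> b \in T = false by apply: disjointFr.
have neSj b : b \in S -> b != j.
  by move=> /inT bT; apply: contraFneq bT => ->.
have neTi b : b \in T -> b != i.
  by move=> bT; apply: contraTneq bT => ->; rewrite inT.
(* The move costs slice [i] two pebbles and lowers [p i] by one, so the bound [#|A| + 2 * p i] is
   preserved. *)
pose p' b := p b - (b == i); pose q' b := q b - (b == j).
have sum_dec (U : {set B}) f k : k \in U -> 0 < f k ->
    \sum_(b in U) (f b - (b == k)) + 1 = \sum_(b in U) f b.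
  move=> kU fk; rewrite (bigD1 k) //= [in RHS](bigD1 k) //= eqxx.
  rewrite (eq_bigr f) => [|b /andP[_ /negbTE->]]; first by lia.
  by rewrite subn0.
have [|b bS||c' [rc' c'S c'T c'n]] := IH p' q' c1.
- by have := sum_dec T q j jT qj; rewrite Dn /q'; lia.
- rewrite /p'; have := pc b bS; have [->|bi] := eqVneq b i => /=; first by lia.
  by rewrite (mb _ bi (neSj _ bS)); lia.
- by have := sum_dec S p i iS pi; rewrite /p'; lia.
exists c'; split.
- by apply: reachable_step rc' => //; exact: e_adjr.
- move=> b bS; have := c'S b bS; rewrite /p'.
  have [->|bi] := eqVneq b i => /=; first by lia.
  by rewrite (mb _ bi (neSj _ bS)); lia.
- move=> b bT; have := c'T b bT; rewrite /q'.
  have [->|bj] := eqVneq b j => /=; first by lia.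
  by rewrite (mb _ (neTi _ bT) bj); lia.
move=> b bS bT; rewrite c'n // mb //.
  by apply: contraNneq bS => ->.
by apply: contraNneq bT => ->.
Qed.

Lemma unsolvable_fiber_pairs (rA : A) (rB : B) (S T : {set B}) (c : config X) :
  [disjoint S & T] -> (forall i j, i \in S -> j \in T -> adj i j) ->
  ~ pebble_solvable c (e rA rB) ->
  (forall i, i \in S -> #|A| <= piA * (fiber_size c i %/ piA)) ->
  piB <= \sum_(b : B) fiber_size c b %/ piA + #|T| ->
  \sum_(i in S) (fiber_size c i %% piA) %/ 2 <
    \sum_(j in T) (piA - fiber_size c j %% piA).
Proof.
move=> disST adjST unsol satS sets; rewrite ltnNge; apply/negP => few.
have piA_gt0 : 0 < piA.
  apply: leq_trans (card_le_pebbling_number rA conA).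
  by apply/card_gt0P; exists rA.
have modlt b := ltn_pmod (fiber_size c b) piA_gt0.
have divE b := divn_eq (fiber_size c b) piA.
(* By unification with [few], the supply [p] is half the remainder, rounded down, and the demand [q]
   is what is missing to the next multiple of [piA]. *)
have [i iS|c' [rc' c'S c'T c'n]] := fibers_transfer (c := c) disST adjST _ few.
  by have := satS i iS; have := divE i; lia.
suff [c2 rc2 c2r] : pebble_solvable c' (e rA rB).
  by apply: unsol; exists c2 => //; exact: reachable_trans rc' rc2.
apply: solvable_fiber_sets; apply: leq_trans sets _.
(* Slice by slice: those in [T] gain a set, and those in [S] lose at most their remainder, hence no
   set. *)
rewrite -sum1_card [X in _ + X]big_mkcond -big_split; apply: leq_sum => b _ /=.
case: (boolP (b \in T)) => bT.
  rewrite leq_divRL // addn1 mulSn.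
  by have := c'T b bT; have := divE b; have := modlt b; lia.
case: (boolP (b \in S)) => bS; last by rewrite c'n // addn0.
rewrite leq_divRL // addn0.
by have := c'S b bS; have := divE b; lia.
Qed.

End Product.

(** * Specialisation to the two choices of [K] *)

Section Slices.
Variables G H : sgraph.

Lemma slice_sizeG (c : config (cprod G H)) (j : H) :
  @slice_size G H SideG c j = fiber_size (fun (i : G) (j : H) => (i, j) : cprod G H) c j.
Proof. by rewrite /slice_size /slice big_imset //= => x y _ _ []. Qed.

Lemma slice_sizeH (c : config (cprod G H)) (j : G) :
  @slice_size G H SideH c j = fiber_size (fun (h : H) (j : G) => (j, h) : cprod G H) c j.
Proof. by rewrite /slice_size /slice big_imset //= => x y _ _ []. Qed.

Lemma slice_extraE K (c : config (cprod G H)) (j : graphKbar G H K) :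
  slice_extra c j = slice_size c j %% pebbling_number (graphK G H K).
Proof.
rewrite /slice_extra /slice_set mulnC.
by have := divn_eq (slice_size c j) (pebbling_number (graphK G H K)); lia.
Qed.

Lemma slice_satE K (c : config (cprod G H)) (j : graphKbar G H K) :
  slice_sat c j =
  (pebbling_number (graphK G H K) * slice_set c j) %/ #|graphK G H K|.
Proof.
rewrite /slice_sat slice_extraE /slice_set; congr (_ %/ _).
by rewrite {1}(divn_eq (slice_size c j) (pebbling_number (graphK G H K))) addnK mulnC.
Qed.

Lemma unsolvable_slice_pairs (rG : G) (rH : H) K (S T : {set graphKbar G H K})
    (c : config (cprod G H)) :
  graph_connected G -> graph_connected H ->
  [disjoint S & T] -> (forall i j, i \in S -> j \in T -> adj i j) ->
  ~ @pebble_solvable (cprod G H) c (rG, rH) ->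
  (forall i, i \in S -> 0 < slice_sat c i) ->
  pebbling_number (graphKbar G H K) <= \sum_(j : graphKbar G H K) slice_set c j + #|T| ->
  \sum_(i in S) slice_pair c i <
    \sum_(j in T) (pebbling_number (graphK G H K) - slice_extra c j).
Proof.
move=> conG conH disST adjST unsol satS sets.
have cardK : 0 < #|graphK G H K|.
  by case: (K); apply/card_gt0P; [exists rG | exists rH].
under eq_bigr do rewrite /slice_pair slice_extraE.
under [ltnRHS]eq_bigr do rewrite slice_extraE.
(* Saturation at least 1 means that the complete sets alone hold [#|K|] pebbles, which is what the
   pigeonhole argument needs. *)
have {}satS i : i \in S -> #|graphK G H K| <= pebbling_number (graphK G H K) *
    (slice_size c i %/ pebbling_number (graphK G H K)).
  by move=> /satS; rewrite slice_satE divn_gt0.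
rewrite /slice_set in sets.
case: K S T disST adjST satS sets {cardK} => /= S T disST adjST satS sets.
- under eq_bigr do rewrite slice_sizeG.
  under [ltnRHS]eq_bigr do rewrite slice_sizeG.
  apply: (unsolvable_fiber_pairs (e := fun i j => (i, j) : cprod G H)
    _ _ _ _ _ (rA := rG) (rB := rH)) => //.
  + by move=> a a' b b' [-> ->].
  + by move=> a a' b aa; rewrite /= /cprod_adj /= eqxx aa orbT.
  + by move=> a b b' bb; rewrite /= /cprod_adj /= eqxx bb.
  + by move=> i iS; rewrite -slice_sizeG; exact: satS.
  by under eq_bigr do rewrite -slice_sizeG.
under eq_bigr do rewrite slice_sizeH.
under [ltnRHS]eq_bigr do rewrite slice_sizeH.
apply: (unsolvable_fiber_pairs (e := fun h j => (j, h) : cprod G H)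
  _ _ _ _ _ (rA := rH) (rB := rG)) => //.
+ by move=> a a' b b' [-> ->].
+ by move=> a a' b aa; rewrite /= /cprod_adj /= eqxx aa.
+ by move=> a b b' bb; rewrite /= /cprod_adj /= eqxx bb orbT.
+ by move=> i iS; rewrite -slice_sizeH; exact: satS.
by under eq_bigr do rewrite -slice_sizeH.
Qed.

End Slices.

(** * The integer inequality and its penalty terms *)

Theorem theorem3 (G H : sgraph) (rG : G) (rH : H) (K : side)
    (S T : {set graphKbar G H K}) (c : config (cprod G H)) :
  graph_connected G -> graph_connected H ->
  [disjoint S & T] ->
  (forall i j, i \in S -> j \in T -> adj i j) ->
  ~ @pebble_solvable (cprod G H) c (rG, rH) ->
  let piK : int := Posz (pebbling_number (graphK G H K)) in
  let piK' : int := Posz (pebbling_number (graphKbar G H K)) in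
  let M : int := (2 * Posz (pebbling_number G) * Posz (pebbling_number H))%R in
  ((\sum_(i in S) Posz (slice_pair c i)) + 1 <=
     (\sum_(j in T) (piK - Posz (slice_extra c j)))
     + M * (Posz #|S| - \sum_(i in S) Posz (x_ind c i 1))
     + M * (1 - Posz (y_ind K c (piK' - Posz #|T|))))%R.
Proof.
move=> conG conH disST adjST unsol; cbv zeta; set M := (2 * _ * _)%R.
set p := pebbling_number (graphK G H K); set p' := pebbling_number (graphKbar G H K).
have pM : M = Posz (2 * (p * p')).
  by rewrite /M /p /p'; case: (K) => /=; lia.
have rK : graphK G H K by case: (K).
have rK' : graphKbar G H K by case: (K).
have conK : graph_connected (graphK G H K) by case: (K).
have conK' : graph_connected (graphKbar G H K) by case: (K).
have p_gt0 : 0 < p.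
  apply: leq_trans (card_le_pebbling_number rK conK).
  by apply/card_gt0P; exists rK.
have card_p' := card_le_pebbling_number rK' conK'; rewrite -/p' in card_p'.
have p'_gt0 : 0 < p' by apply: leq_trans card_p'; apply/card_gt0P; exists rK'.
have extra_lt (j : graphKbar G H K) : slice_extra c j < p by rewrite slice_extraE ltn_pmod.
have sumPosz (I : finType) (P : pred I) (f : I -> nat) :
    (\sum_(i | P i) Posz (f i))%R = Posz (\sum_(i | P i) f i).
  by rewrite (big_morph Posz PoszD (erefl _)).
(* Since the extra is below [p], the integer differences agree with the truncated ones. *)
have -> : (\sum_(j in T) (Posz p - Posz (slice_extra c j)))%R =
    Posz (\sum_(j in T) (p - slice_extra c j)).
  by rewrite -sumPosz; apply: eq_bigr => j _; have := extra_lt j; lia.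
rewrite !sumPosz pM.
set D := \sum_(j in T) _; set P := \sum_(i in S) _; set X1 := \sum_(i in S) _.
have x_le1 (i : graphKbar G H K) : x_ind c i 1 <= 1 by rewrite /x_ind; case: ifP.
have X1_le : X1 <= #|S| by rewrite -sum1_card; apply: leq_sum.
(* Each pair number is below [p] and [#|S| <= p'], so [P <= p' * p]; the factor 2 in [M] leaves room
   for the added 1. *)
have PM : P + 1 <= 2 * (p * p').
  have : P <= p' * p.
    apply: (@leq_trans (#|S| * p)).
      rewrite -sum_nat_const; apply: leq_sum => i _.
      by rewrite /slice_pair; have := extra_lt i; lia.
    by rewrite leq_mul2r (leq_trans (max_card _) card_p') orbT.
  have : 0 < p * p' by rewrite muln_gt0 p_gt0.
  by rewrite (mulnC p'); lia.
(* From here on, [P + 1 <= m] is all that matters about [M]. *)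
move: (2 * (p * p')) PM => m PM.
(* If some [x] vanishes, the first penalty is at least [m], and the other terms on the right are
   nonnegative. *)
have [X1lt|X1ge] := ltnP X1 #|S|.
  have y_le1 : y_ind K c (Posz p' - Posz #|T|)%R <= 1 by rewrite /y_ind; case: ifP.
  by nia.
have satS i : i \in S -> 0 < slice_sat c i.
  move=> iS; rewrite lt0n; apply/eqP => sat0; move: X1ge.
  rewrite leqNgt /X1 -sum1_card => /negP[].
  rewrite (bigD1 i) //= [ltnRHS](bigD1 i) //= {1}/x_ind sat0 /= add0n add1n ltnS.
  exact: leq_sum.
(* If [y] vanishes, the second penalty equals [m]; otherwise both penalties are zero and [P < D]
   remains. *)
rewrite /y_ind; case: ifP => [sets|_]; last by nia.
suff : P < D by nia.
apply: (unsolvable_slice_pairs conG conH disST adjST unsol satS).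
by move: sets; rewrite -/p'; lia.
Qed.
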